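(* Let $\lambda$ be a Ferrers shape, let $k$ be a positive integer and let $\sigma=\sigma_k(\lambda)$. The complementary map $F\mapsto \lambda\setminus F$ is a bijection from the set $\mathcal{F}_{NE}(\lambda,k)$ of $k$-north-east fillings of $\lambda$ to the set $\mathcal{RP}(\sigma)$ of reduced pipe dreams of $\sigma$ (where fillings are identified with their sets of boxes filled with $1$, and pipe dreams with their sets of crossing boxes).
   Context: Boxes are $(\text{row},\text{column})$, rows numbered from top to bottom and columns from left to right. A Ferrers shape $\lambda=(\lambda_1\ge\lambda_2\ge\cdots)$ is the set of boxes $(i,j)$ with $1\le j\le\lambda_i$. A north-east chain of length $\ell$ in $\lambda$ is a sequence of $\ell$ boxes of $\lambda$ such that each box is strictly north and strictly east of the preceding one, and the smallest rectangle containing all boxes of the sequence is contained in $\lambda$. A $k$-north-east filling of $\lambda$ is a $(0,1)$-filling of $\lambda$ containing no north-east chain of $1$'s of length $k+1$ and in which the number of $1$'s is maximal. Let $n$ be such that the staircase $(n-1,\dots,2,1)$ is the smallest staircase containing $\lambda$. A pipe dream of size $n$ is a filling of the boxes of the staircase $(n-1,\dots,2,1)$ in which each box contains either two crossing pipes (one joining left and right edges, one joining top and bottom edges) or two turning pipes (one joining left and top edges, one joining bottom and right edges); the boxes $(i,n+1-i)$ carry one turning pipe joining left and top edges. Its permutation $\pi\in\mathcal{S}_n$ is given by $\pi_i=j$ if the pipe starting at the top of column $j$ ends at the left of row $i$. A pipe dream is reduced if any two pipes cross at most once. A pipe dream is identified with its set of boxes containing crossings. $\mathcal{RP}(\sigma)$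 is the set of reduced pipe dreams (of size $n$) with permutation $\sigma$. The (Rothe) diagram of $\sigma\in\mathcal{S}_n$ is $\mathrm{D}(\sigma)=\{(i,\sigma_j): i<j,\ \sigma_i>\sigma_j\}$; a permutation is determined by its diagram. Let $\mu$ be obtained from $\lambda$ by removing its first $k$ rows and first $k$ columns. Then $\sigma_k(\lambda)$ is the permutation $[1,\dots,k,\tau_1+k,\tau_2+k,\dots]$, where $\tau$ is the unique (dominant) permutation with $\mathrm{D}(\tau)=\mu$; equivalently $\sigma_k(\lambda)$ is the permutation in $\mathcal{S}_n$ whose diagram is $\mu$ shifted so that its north-west corner lies in box $(k+1,k+1)$. (Permutations are extended by fixed points, resp. trailing fixed points dropped, as needed.) *)

(* Defs.v *)
From mathcomp Require Import all_boot all_fingroup.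

Set Implicit Arguments.
Unset Strict Implicit.
Unset Printing Implicit Defensive.

(* Rows, columns and permuted letters are numbered from 0: the box written   *)
(* (i, j) in 1-based notation is (i-1, j-1) here.  All boxes live in the     *)
(* n x n square, where n is the size of the pipe dreams.                     *)

Notation box n := ('I_n * 'I_n)%type.

Definition is_partition (lam : seq nat) : bool := sorted geq lam.

Definition in_shape (lam : seq nat) (i j : nat) : bool := j < nth 0 lam i.

(* The staircase (n-1, ..., 2, 1). *)
Definition in_stair (n i j : nat) : bool := i + j + 1 < n.

Definition stair_contains (n : nat) (lam : seq nat) : Prop :=
  forall i j, in_shape lam i j -> in_stair n i j.

(* For the empty shape this gives n = 1. *)
Definition smallest_stair (n : nat) (lam : seq nat) : Prop :=
  [/\ 0 < n, stair_contains n lam &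
      forall m, 0 < m -> stair_contains m lam -> n <= m].

Definition ferrers (n : nat) (lam : seq nat) : {set box n} :=
  [set b : box n | in_shape lam b.1 b.2].

Definition stair (n : nat) : {set box n} :=
  [set b : box n | in_stair n b.1 b.2].

Section Fillings.
Variable n : nat.
Implicit Types (L F : {set box n}) (s : seq (box n)).

Definition bounding_rect s : {set box n} :=
  [set b : box n |
    [&& has (fun c : box n => c.1 <= b.1) s, has (fun c : box n => b.1 <= c.1) s,
        has (fun c : box n => c.2 <= b.2) s & has (fun c : box n => b.2 <= c.2) s]].

Definition ne_step (a b : box n) : bool := (b.1 < a.1) && (a.2 < b.2).

Definition ne_chain L s : bool :=
  [&& sorted ne_step s, all (mem L) s & bounding_rect s \subset L].

Definition ne_free L (k : nat) F : bool :=
  (F \subset L) &&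
  [forall s : k.+1.-tuple (box n), ne_chain L s ==> ~~ all (mem F) s].

Definition ne_fillings L (k : nat) : {set {set box n}} :=
  [set F : {set box n} | ne_free L k F & [forall G, ne_free L k G ==> (#|G| <= #|F|)]].

End Fillings.

Section PipeDreams.
Variable n : nat.
Implicit Types (P : {set box n}) (s : 'S_n).

Definition has_cross P (i j : nat) : bool :=
  [exists b in P, (b.1 == i :> nat) && (b.2 == j :> nat)].

(* The boxes visited by the pipe that enters box (i, j) from the top if      *)
(* [down] and from the right otherwise.  A crossing keeps the heading; a     *)
(* turn sends a pipe coming from the top to the left, and one coming from    *)
(* the right to the bottom.  The pipe ends at the left edge of column 0.     *)
Fixpoint trace P (fuel i j : nat) (down : bool) : seq (nat * nat) :=
  if fuel is f.+1 then
    (i, j) :: (if has_cross P i j == down then trace P f i.+1 j true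
               else if j is j'.+1 then trace P f i j' false
               else [::])
  else [::].

(* The pipe starting at the top of column j.  Each step increases i - j by   *)
(* 1, so a pipe inside the staircase visits fewer than 2n boxes.             *)
Definition pipe P (j : nat) : seq (nat * nat) := trace P (2 * n) 0 j true.

Definition pipe_row P (j : nat) : nat := (last (0, 0) (pipe P j)).1.

Definition pd_perm P s : bool := [forall i : 'I_n, pipe_row P (s i) == i].

Definition shared_crossings P (a b : nat) : {set box n} :=
  [set c in P | ((c.1 : nat, c.2 : nat) \in pipe P a)
              && ((c.1 : nat, c.2 : nat) \in pipe P b)].

Definition reduced P : bool :=
  [forall a : 'I_n, forall b : 'I_n,
     (a != b) ==> (#|shared_crossings P a b| <= 1)].

Definition reduced_pipe_dreams s : {set {set box n}} :=
  [set P : {set box n} | [&& P \subset stair n, pd_perm P s & reduced P]].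

Definition rothe s : {set box n} :=
  [set (p.1, s p.2) | p in [set p : box n | (p.1 < p.2) && (s p.2 < s p.1)]].

End PipeDreams.

(* Removing the first k rows and columns of lam and translating the result   *)
(* so that its north-west corner is again in (0-based) box (k, k).           *)
Definition shifted_core (n : nat) (lam : seq nat) (k : nat) : {set box n} :=
  [set b in ferrers n lam | (k <= b.1) && (k <= b.2)].

(* The permutation [1, ..., k, tau_1 + k, tau_2 + k, ...], for tau the       *)
(* dominant permutation whose diagram is lam without its first k rows and    *)
(* columns, given as the permutation of 'S_n of diagram [shifted_core].  It  *)
(* exists by [rothe_sigma_k] and is unique by [rothe_inj] below.             *)
Definition sigma_k (n : nat) (lam : seq nat) (k : nat) : 'S_n :=
  odflt 1%g [pick s : 'S_n | rothe s == shifted_core n lam k].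

Lemma in_rothe n (s : 'S_n) (i j : 'I_n) :
  ((i, j) \in rothe s) = (j < s i) && (i < (s^-1)%g j).
Proof.
apply/imsetP/andP => [[[a b]]|[ji ij]].
  by rewrite inE /= => /andP[ab ba] [-> ->]; rewrite permK.
by exists (i, (s^-1)%g j); rewrite ?inE /= permKV // ij ji.
Qed.

Lemma rothe_inj n : injective (@rothe n).
Proof.
move=> s t st; apply/permP => i.
have [m] := ubnP (val i); elim: m i => // m IH i /ltnSE im.
have key (u v : 'S_n) : rothe u = rothe v ->
    (forall i' : 'I_n, i' < i -> u i' = v i') -> v i <= u i.
  move=> uv low; rewrite leqNgt; apply/negP => lt_uv.
  have : (i, u i) \notin rothe u by rewrite in_rothe ltnn.
  rewrite uv in_rothe lt_uv /= -leqNgt leq_eqVlt => /orP[/eqP/val_inj E|lt].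
    by move: lt_uv; rewrite -[in v i]E permKV ltnn.
  have /perm_inj E : u ((v^-1)%g (u i)) = u i by rewrite low // permKV.
  by rewrite E ltnn in lt.
have low (i' : 'I_n) : i' < i -> s i' = t i'.
  by move=> lt; apply: IH; apply: leq_trans lt im.
by apply/val_inj/eqP; rewrite eqn_leq !key // => i' /low.
Qed.

Section Existence.
Variables (n : nat) (lam : seq nat) (k : nat).
Hypothesis lam_part : is_partition lam.
Hypothesis lam_stair : stair_contains n lam.

(* Each letter is the least unused one outside the row of the diagram. *)
Let good (u : seq nat) x :=
  (x \notin u) && ((k <= size u) && (k <= x) ==> (nth 0 lam (size u) <= x)).
Let next u := find (good u) (iota 0 n).
Let word := fix word m := if m is m'.+1 then rcons (word m') (next (word m'))
                          else [::].

Let size_word m : size (word m) = m.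
Proof. by elim: m => //= m IH; rewrite size_rcons IH. Qed.

Let nth_word m i : i < m -> nth 0 (word m) i = next (word i).
Proof.
elim: m => //= m IH; rewrite ltnS nth_rcons size_word leq_eqVlt.
by case/orP=> [/eqP->|lt]; [rewrite ltnn eqxx | rewrite lt IH].
Qed.

Let row_bound i : i < n -> nth 0 lam i + i <= n.
Proof.
move=> lin; case E: (nth 0 lam i) => [|x] //; first exact: ltnW.
have := @lam_stair i x; rewrite /in_shape E ltnSn => /(_ isT).
by rewrite /in_stair addn1 addnC -addSn => /ltnW; rewrite addSnnS addnC addSnnS addnC.
Qed.

Let next_good m : m < n -> good (word m) (next (word m)) /\ next (word m) < n.
Proof.
move=> mn; set u := word m.
have su : size u = m by exact: size_word.
suff: has (good u) (iota 0 n).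
  move=> H; have lt: next u < n by move: H; rewrite has_find size_iota.
  by split=> //; have := nth_find 0 H; rewrite nth_iota // add0n.
apply/negPn/negP => /hasPn none.
pose v := iota (nth 0 lam m) (n - nth 0 lam m).
have vu : {subset v <= u}.
  move=> x; rewrite mem_iota => /andP[lx].
  have := row_bound mn => rb.
  rewrite subnKC; last exact: leq_trans (leq_addr _ _) rb.
  move=> xn; have := none x; rewrite mem_iota add0n xn => /(_ isT).
  by rewrite /good su lx implybT andbT negbK.
have := uniq_leq_size (iota_uniq _ _) vu; rewrite size_iota su => le.
have := row_bound mn => rb.
case E: (nth 0 lam m) => [|x]; first by move: le; rewrite E subn0 leqNgt mn.
have := @lam_stair m x; rewrite /in_shape E ltnSn => /(_ isT).
rewrite /in_stair addn1 -addnS -E addnC => lt.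
by move: le; rewrite leq_subLR leqNgt lt.
Qed.

Let next_min m x : x < next (word m) -> x < n -> ~~ good (word m) x.
Proof.
move=> lt xn; have := before_find 0 lt.
by rewrite nth_iota // add0n => ->.
Qed.

Let next_notin m i : m < n -> i < m -> next (word i) != next (word m).
Proof.
move=> mn im; have [/andP[+ _] _] := next_good mn.
by apply: contraNneq => <-; rewrite -(nth_word im) mem_nth // size_word.
Qed.

Let f (i : 'I_n) : 'I_n := Ordinal (next_good (ltn_ord i)).2.

Let f_inj : injective f.
Proof.
move=> i j /(congr1 val) /= E; apply/val_inj => /=.
case: (ltngtP i j) => // lt.
  by have := next_notin (ltn_ord j) lt; rewrite E eqxx.
by have := next_notin (ltn_ord i) lt; rewrite E eqxx.
Qed.

Let mem_word m x : m <= n ->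
  reflect (exists2 i : 'I_n, i < m & f i = x :> nat) (x \in word m).
Proof.
move=> mn; apply: (iffP idP) => [|[i im <-]].
  case/(nthP 0) => i; rewrite size_word => im <-.
  by exists (Ordinal (leq_trans im mn)) => //=; rewrite nth_word.
by rewrite /= -(nth_word im) mem_nth // size_word.
Qed.

Let next_small i : i < k -> i < n -> next (word i) = i.
Proof.
have [m] := ubnP i; elim: m i => // m IH i /ltnSE im ik lin.
have E x : x < n -> good (word i) x = (i <= x).
  move=> xn; rewrite /good size_word leqNgt ik andbT leqNgt; congr (~~ _).
  apply/(mem_word _ (ltnW lin))/idP => [[j ji <-]|xi].
    by rewrite /= IH ?(leq_trans ji) // ltnW.
  exists (Ordinal xn) => //=.
  by apply: IH => //; [apply: leq_trans im | apply: ltn_trans ik].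
have [g lt] := next_good lin; apply/eqP; rewrite eqn_leq -(E _ lt) g andbT.
rewrite leqNgt; apply/negP => lti.
by have := next_min lti lin; rewrite E // leqnn.
Qed.

Lemma rothe_exists : exists s : 'S_n, rothe s = shifted_core n lam k.
Proof.
exists (perm f_inj); apply/setP => -[i j]; rewrite in_rothe !inE /= permE.
set h := ((perm f_inj)^-1)%g j; have Eh : f h = j by rewrite -(permE f_inj) permKV.
have unused : (i <= h) = ((j : nat) \notin word i).
  rewrite leqNgt; congr (~~ _).
  apply/idP/(mem_word _ (ltnW (ltn_ord i))) => [hi|[h' hi E]].
    by exists h => //; rewrite Eh.
  by have -> : h = h' by apply: f_inj; rewrite Eh; apply: val_inj.
have [/andP[_ g] _] := next_good (ltn_ord i).
apply/andP/and3P => [[ji ih]|[sh ki kj]].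
  have := next_min ji (ltn_ord j).
  rewrite /good -unused (ltnW ih) size_word /= negb_imply -ltnNge.
  by rewrite /in_shape => /andP[/andP[-> ->] ->].
have above (i' : 'I_n) : i' <= i -> k <= i' -> j < f i'.
  move=> ii ki'; have [/andP[_ g'] _] := next_good (ltn_ord i').
  have le : nth 0 lam i <= nth 0 lam i'.
    case: (ltnP i (size lam)) => [li|/(nth_default 0)->] //.
    have gt : transitive geq by move=> a b c ab bc; apply: leq_trans ab.
    by apply: (sorted_leq_nth gt leqnn 0 lam_part) => //; rewrite inE //;
       apply: leq_ltn_trans li.
  have jl := leq_trans sh le; move: g'; rewrite size_word ki' /=.
  case: (leqP k (next (word i'))) => [_ /= g'|lt _].
    exact: leq_trans g'.
  (* a letter below k has been used by a row above k *)
  have kn : next (word i') < n by apply: (next_good (ltn_ord i')).2.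
  have lti' := leq_trans lt ki'.
  by have := next_notin (ltn_ord i') lti'; rewrite next_small // eqxx.
have fi := above i (leqnn i) ki; split=> //.
rewrite ltnNge leq_eqVlt; apply/negP => /orP[/eqP/val_inj E|hi].
  by move: fi; rewrite -E Eh ltnn.
case: (leqP k h) => [kh|hk].
  by have := above h (ltnW hi) kh; rewrite Eh ltnn.
have := congr1 val Eh; rewrite /= next_small // => E.
by move: kj; rewrite -E leqNgt hk.
Qed.

Lemma rothe_sigma_k : rothe (sigma_k n lam k) = shifted_core n lam k.
Proof.
rewrite /sigma_k; case: pickP => [s /eqP //|none].
by have [s /eqP] := rothe_exists; rewrite none.
Qed.

End Existence.

(* Main.v *)
Require Import Defs.
From mathcomp Require Import all_boot all_fingroup.
From mathcomp Require Import zify.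

Set Implicit Arguments.
Unset Strict Implicit.
Unset Printing Implicit Defensive.

(** The complement of a filling is read as a pipe dream whose pipes are
    sticky: number the pipes by the columns they start in, and let the two
    pipes of a crossing box really cross only if the one coming from the top
    has the smaller number, that is, if they have not crossed before.  Let w be
    the permutation that the sticky pipes of P produce.  Two facts about w give
    the theorem.

    Counting.  Each effective crossing adds exactly one inversion to the word
    of labels along the boundary of the region already traversed, so that w has
    as many inversions as P has effective crossings ([exits_inversions]).
    Hence w has at most #|P| inversions, and equality means that every crossing
    is effective, in which case sticky and ordinary pipes agree and P is a
    reduced pipe dream of w ([reduced_pipe_dreamP]).

    Chains.  For a threshold j, the number of labels exceeding j on the edges
    above row i in columns c..j obeys the recursion of longest common
    subsequences, and is therefore the length of the longest north-east chain
    of non-crossing boxes in rows < i and columns c..j ([chain_size_excess],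
    [chain_of_excess]).  For c = 0 it is also the number of rows a < i with
    w a <= j.  Call #{a <= i : w a <= j} the rank of w at (i, j).  Then the
    chains of the complement of P in the rectangle with corner (i, j) have at
    most k boxes iff w has rank at most k at (i, j).

    Consequently a subset F of the shape has no chain of length k + 1 iff the w
    of its complement has rank at most k at all boxes of the shape.  Such a w
    is above sigma in Bruhat order: unless w = sigma, a transposition lowers
    the number of inversions and keeps the rank conditions
    ([rank_bounded_inversions]).  Thus complements of chain-free sets have at
    least inv(sigma) boxes, with equality only for reduced pipe dreams of
    sigma.  The bound is attained ([ne_free_exists]), so the maximal fillings
    are exactly the chain-free ones whose complement has inv(sigma) boxes.
    Conversely the complement of a reduced pipe dream of sigma is chain-free,
    and the same bound applied to its part inside the shape leaves no box
    outside ([pipe_dream_in_shape]). *)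

(** * Weighted inversions of words *)
Section InversionCount.
Variable e : rel nat.

(** The weight [e] selects which inverted pairs are counted: all of them, or
    only one prescribed pair of values. *)
Fixpoint inversions (s : seq nat) : nat :=
  if s is x :: s' then count (e x) s' + inversions s' else 0.

Lemma inversions_swap s1 x y s2 :
  inversions (s1 ++ x :: y :: s2) + e y x =
  inversions (s1 ++ y :: x :: s2) + e x y.
Proof.
elim: s1 => [|z s1 IH] /=; first by lia.
by rewrite -!addnA IH; congr (_ + _); rewrite !count_cat /=; lia.
Qed.

Lemma inversions_adjacent s1 x y s2 : e x y <= inversions (s1 ++ x :: y :: s2).
Proof. by elim: s1 => [|z s1 IH] /=; lia. Qed.

Lemma inversions_rcons s y :
  inversions (rcons s y) = inversions s + count (e^~ y) s.
Proof. by elim: s => //= x s ->; rewrite -cats1 count_cat /=; lia. Qed.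

Lemma inversions_rcons0 s y :
  {in s, forall x, e x y = false} -> inversions (rcons s y) = inversions s.
Proof.
move=> h; rewrite inversions_rcons -[RHS]addn0; congr (_ + _).
by rewrite -[RHS](count_pred0 s); apply: eq_in_count.
Qed.

Lemma inversions_mkseq (f : nat -> nat) n :
  inversions (mkseq f n) =
  \sum_(x < n) \sum_(y < n) ((x < y) && e (f x) (f y)).
Proof.
elim: n => [|n IH]; first by rewrite big_ord0.
rewrite mkseqS inversions_rcons IH big_ord_recr /=.
rewrite [X in _ = _ + X]big1 => [|y _]; last first.
  by rewrite ltnNge -ltnS ltn_ord.
under [in RHS]eq_bigr => x _ do rewrite big_ord_recr /= ltn_ord.
rewrite big_split addn0 /= -sum1_count big_map /=.
have -> : iota 0 n = index_iota 0 n by rewrite /index_iota subn0.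
rewrite big_mkord; congr (_ + _).
by rewrite big_mkcond; apply: eq_bigr => x _; case: (e _ _).
Qed.

End InversionCount.

(** * Sticky pipes *)
Section Labels.
Variables (n : nat) (cr : nat -> nat -> bool).
Hypothesis cr_stair : forall i c, cr i c -> in_stair n i c.

(** The label leaving box [c] of a row to the left, when [t] gives the labels
    entering the row from the top and [x] its crossings.  The label entering
    box [c] from the right leaves box [c.+1], whence the recursion to the
    right; it may start at column [n], where no box is a crossing.  The pipes
    entering from the right border thereby get the labels [n], [n.+1], ... of
    the columns beyond it. *)
Fixpoint row_left_label (x : nat -> bool) (t : nat -> nat) (fuel c : nat) : nat :=
  if fuel is f.+1 then
    let r := row_left_label x t f c.+1 in if x c && (t c < r) then r else t c
  else t c.

Fixpoint top_label (i : nat) : nat -> nat :=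
  if i is i'.+1 then fun c =>
    let r := row_left_label (cr i') (top_label i') (n - c.+1) c.+1 in
    if cr i' c && (top_label i' c < r) then top_label i' c else r
  else id.

Definition left_label (i c : nat) : nat := row_left_label (cr i) (top_label i) (n - c) c.

(** A crossing where the pipes do swap.  If the label on top is the larger one,
    the two pipes have crossed before. *)
Definition effective (i c : nat) : bool := cr i c && (top_label i c < left_label i c.+1).

Lemma top_labelS i c :
  top_label i.+1 c = if effective i c then top_label i c else left_label i c.+1.
Proof. by []. Qed.

Lemma left_labelE i c :
  left_label i c = if effective i c then left_label i c.+1 else top_label i c.
Proof.
rewrite /effective {1}/left_label; case: (ltnP c n) => cn.
  by rewrite -subnSK.
have /eqP -> : n - c == 0 by rewrite subn_eq0.
by case: ifP => //= /andP[/cr_stair]; rewrite /in_stair; lia.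
Qed.

(** A pipe never gets to the right of the column it starts in. *)
Lemma label_ge i : (forall c, c <= top_label i c) /\ (forall c, c <= left_label i c).
Proof.
have H i' : (forall c, c <= top_label i' c) -> (forall c, c <= left_label i' c).
  move=> ht c; rewrite /left_label; move: (n - c) => f; elim: f c => [|f IH] c //=.
  by case: ifP => // _; apply: ltnW.
elim: i => [|i [IHt IHl]]; first by split=> //; exact: H.
suff ht c : c <= top_label i.+1 c by split=> //; exact: H.
by rewrite top_labelS; case: ifP => // _; apply: ltnW.
Qed.

Lemma left_label_ge i c : c <= left_label i c. Proof. exact: (label_ge i).2. Qed.

Lemma not_cr i c : n <= i + c + 1 -> cr i c = false.
Proof. by move=> h; apply/negP => /cr_stair; rewrite /in_stair; lia. Qed.

(** Beyond the staircase all boxes turn, so labels move along antidiagonals. *)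
Lemma top_label_out i c : n <= i + c -> top_label i c = i + c.
Proof.
elim: i c => // i IH c h.
rewrite top_labelS /effective not_cr /=; last by lia.
rewrite left_labelE /effective not_cr /=; last by lia.
by rewrite IH; lia.
Qed.

Lemma left_label_out i c : n <= i + c -> left_label i c = i + c.
Proof. by move=> h; rewrite left_labelE /effective not_cr ?top_label_out //=; lia. Qed.

Lemma label_lt i :
  (forall c, i + c < n -> top_label i c < n) /\
  (forall c, i + c < n -> left_label i c < n).
Proof.
have H i' : (forall c, i' + c < n -> top_label i' c < n) ->
    (forall c, i' + c < n -> left_label i' c < n).
  move=> ht c; have [m] := ubnP (n - c); elim: m c => // m IH c cm icn.
  rewrite left_labelE; case: ifP => [/andP[/cr_stair]|_]; last exact: ht.
  by rewrite /in_stair => icn' _; apply: IH; lia.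
elim: i => [|i [IHt IHl]]; first by split=> //; exact: H.
suff ht c : i.+1 + c < n -> top_label i.+1 c < n by split=> //; exact: H.
by rewrite top_labelS => h; case: ifP => _; [apply: IHt | apply: IHl]; lia.
Qed.

(** The labels along the border of the region traversed when the rows above
    [i] and the boxes of row [i] from column [c] on have been processed, each
    row from right to left. *)
Definition frontier (i c : nat) : seq nat :=
  mkseq (left_label^~ 0) i ++ map (top_label i) (iota 0 c) ++
  left_label i c :: map (top_label i.+1) (iota c (n - c)).

(** Processing a box affects two adjacent entries of the frontier. *)
Lemma frontier_step i c : c < n ->
  exists s1 s2, frontier i c.+1 = s1 ++ top_label i c :: left_label i c.+1 :: s2 /\
    frontier i c = s1 ++ left_label i c :: top_label i.+1 c :: s2.
Proof.
move=> cn; exists (mkseq (left_label^~ 0) i ++ map (top_label i) (iota 0 c)).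
exists (map (top_label i.+1) (iota c.+1 (n - c.+1))); split; rewrite /frontier.
  by rewrite -addn1 iotaD map_cat -!catA /= add0n addn1.
by rewrite -subnSK //= -!catA.
Qed.

Lemma frontier_row i : frontier i.+1 n = rcons (frontier i 0) (i.+1 + n).
Proof.
rewrite /frontier mkseqS subnn subn0 -!cats1 -!catA /= (@left_label_out i.+1) //; lia.
Qed.

Lemma frontier0 : frontier 0 n = iota 0 n.+1.
Proof.
by rewrite /frontier subnn left_label_out // -[n.+1]addn1 iotaD /= map_id.
Qed.

Lemma frontier_ind (Q : nat -> nat -> Prop) :
  Q 0 n -> (forall i c, c < n -> Q i c.+1 -> Q i c) ->
  (forall i, Q i 0 -> Q i.+1 n) -> forall i c, c <= n -> Q i c.
Proof.
move=> Q0 Qstep Qrow.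
have H i : Q i n -> forall c, c <= n -> Q i c.
  move=> Qn c cn; rewrite -(subKn cn).
  elim: (n - c) (leq_subr c n) => [|d IH] dn; first by rewrite subn0.
  by apply: Qstep; [lia | rewrite subnSK //; apply: IH; lia].
elim=> [|i IH]; first exact: H.
by apply: H; apply: Qrow; apply: IH.
Qed.

Lemma frontier_perm i c : c <= n -> perm_eq (frontier i c) (iota 0 (i + n).+1).
Proof.
move: i c; apply: frontier_ind => [|i c cn|i H].
- by rewrite frontier0 add0n.
- have [s1 [s2 [-> ->]]] := frontier_step i cn; apply: perm_trans.
  rewrite perm_cat2l left_labelE top_labelS; case: ifP => _ //.
  by rewrite -[_ :: _]/([:: _] ++ [:: _] ++ s2) perm_catCA.
rewrite frontier_row -[(_ + _).+1]addn1 iotaD -cats1 perm_cat2r addSn.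
exact: H.
Qed.

Lemma frontier_uniq i c : c <= n -> uniq (frontier i c).
Proof. by move/(frontier_perm i)/perm_uniq->; apply: iota_uniq. Qed.

Lemma labels_neq i c : c < n -> top_label i c != left_label i c.+1.
Proof.
move=> cn; have := frontier_uniq i cn.
have [s1 [s2 [-> _]]] := frontier_step i cn.
rewrite cat_uniq /= => /and3P[_ _ /andP[+ _]].
by rewrite inE negb_or => /andP[].
Qed.

(** An effective crossing turns the adjacent pair [top < left] of the frontier
    into an inversion, and all other boxes leave the frontier unchanged. *)
Lemma frontier_inversions (e : rel nat) :
  (forall x y, e x y -> y < x) -> forall i c, c <= n ->
  inversions e (frontier i c) =
    \sum_(0 <= a < i) \sum_(0 <= d < n)
       (effective a d && e (left_label a d.+1) (top_label a d)) +
    \sum_(c <= d < n) (effective i d && e (left_label i d.+1) (top_label i d)).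
Proof.
move=> e_gt.
have e_le x y : x <= y -> e x y = false.
  by move=> xy; apply/negP => /e_gt; rewrite ltnNge xy.
apply: frontier_ind => [|i c cn IH|i IH].
- rewrite !big_geq // frontier0.
  elim: (n.+1) => // m IH; rewrite -addn1 iotaD cats1 inversions_rcons0 // => x.
  by rewrite mem_iota => h; rewrite e_le; lia.
- rewrite (big_ltn cn) addnCA -IH.
  have [s1 [s2 [-> ->]]] := frontier_step i cn.
  rewrite left_labelE top_labelS; case: ifP => [/andP[_ lt]|//].
  by have := inversions_swap e s1 (left_label i c.+1) (top_label i c) s2;
     rewrite (e_le (top_label i c)) ?(ltnW lt) //; lia.
rewrite frontier_row inversions_rcons0 => [|x].
  by rewrite IH big_nat_recr //= (big_geq (leqnn n)) addn0.
by rewrite (perm_mem (frontier_perm i _)) // mem_iota => h; rewrite e_le; lia.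
Qed.

Lemma frontier_last :
  frontier n n = mkseq (left_label^~ 0) n ++ iota n n.+1.
Proof.
rewrite /frontier subnn left_label_out; last by lia.
have -> : iota n n.+1 = iota n n ++ [:: n + n] by rewrite -addn1 iotaD.
congr (_ ++ (_ ++ _)); have := iotaDl n 0 n; rewrite addn0 => ->.
by apply: eq_map => c; rewrite top_label_out // leq_addr.
Qed.

(** Past the last row the frontier ends with the labels [n], ..., [n + n] of the
    antidiagonals outside the staircase, so the exits use up the labels below
    [n]. *)
Lemma exit_perm : perm_eq (mkseq (left_label^~ 0) n) (iota 0 n).
Proof.
have := frontier_perm n (leqnn n).
by rewrite frontier_last -addnS iotaD perm_cat2r.
Qed.

Lemma exit_inj i i' : i < n -> i' < n -> left_label i 0 = left_label i' 0 -> i = i'.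
Proof.
have /mkseq_uniqP inj : uniq (mkseq (left_label^~ 0) n).
  by rewrite (perm_uniq exit_perm) iota_uniq.
by move=> ? ?; apply: inj; rewrite inE.
Qed.

Lemma exit_inversions (e : rel nat) : (forall x y, e x y -> y < x) ->
  \sum_(x < n) \sum_(y < n) ((x < y) && e (left_label x 0) (left_label y 0)) =
  \sum_(a < n) \sum_(d < n) (effective a d && e (left_label a d.+1) (top_label a d)).
Proof.
move=> e_gt; have := frontier_inversions e_gt n (leqnn n).
rewrite (big_geq (leqnn n)) addn0 big_mkord.
under [in X in _ = X]eq_bigr => a _ do rewrite big_mkord.
move=> <-; rewrite -(inversions_mkseq e (left_label^~ 0)) frontier_last.
elim: (n.+1) => [|m IH]; first by rewrite cats0.
rewrite -[m.+1]addn1 iotaD catA cats1 inversions_rcons0 // => x.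
rewrite mem_cat (perm_mem exit_perm) !mem_iota => h.
by apply/negP => /e_gt; lia.
Qed.

(** * Labels exceeding a threshold *)
Definition excess (j i c : nat) : nat := \sum_(c <= d < j.+1) (j < top_label i d).

Lemma excess_recl j i c : c <= j -> excess j i c = (j < top_label i c) + excess j i c.+1.
Proof. by move=> cj; rewrite /excess big_ltn. Qed.

(** The labels above [j] in columns [c..j] change only through the two ends of
    the row: one of them enters box [j] from the right, where all labels exceed
    [j], and the label leaving box [c] to the left is lost. *)
Lemma excess_row j i c : c <= j.+1 ->
  excess j i.+1 c + (j < left_label i c) = excess j i c + 1.
Proof.
move=> cj; rewrite -(subKn cj).
elim: (j.+1 - c) (leq_subr c j.+1) => [|d IH] dj.
  by rewrite subn0 /excess !big_geq // left_label_ge.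
have {IH}/(_ (ltnW dj)) := IH; set b := j.+1 - d.+1.
have -> : j.+1 - d = b.+1 by rewrite subnSK.
have bj : b <= j by rewrite /b; lia.
by rewrite !(excess_recl _ bj) top_labelS (left_labelE i b); case: ifP => _; lia.
Qed.

(** Together with [excess_cross] this is the recursion for longest chains: a
    chain either uses the non-crossing box [(i, c)] as its south-west end or
    avoids it. *)
Lemma excess_turn j i c : c <= j -> ~~ cr i c ->
  excess j i.+1 c = (excess j i c.+1).+1.
Proof.
move=> cj /negbTE ncr; have := excess_row i (leqW cj).
by rewrite (left_labelE i c) /effective ncr (excess_recl i cj) /=; lia.
Qed.

Lemma excess_cross j i c : c <= j -> cr i c ->
  excess j i.+1 c = maxn (excess j i c) (excess j i.+1 c.+1).
Proof.
move=> cj cri; have := excess_row i (leqW cj); have /= := @excess_row j i c.+1 cj.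
rewrite (left_labelE i c) !(excess_recl _ cj) top_labelS /effective cri /=.
by case: (leqP (left_label i c.+1) (top_label i c)); lia.
Qed.

Lemma excess_leq j i c i' c' : i <= i' -> c' <= c -> c <= j.+1 ->
  excess j i c <= excess j i' c'.
Proof.
move=> ii cc cj; apply: leq_trans (_ : excess j i' c <= _).
  rewrite -(subnKC ii); elim: (i' - i) => [|d IH]; first by rewrite addn0.
  by apply: leq_trans IH _; rewrite addnS; have := excess_row (i + d) cj; lia.
by rewrite /excess [leqRHS](big_cat_nat (n := c)) //= leq_addl.
Qed.

Lemma excess_exit j i : excess j i 0 = \sum_(a < i) (left_label a 0 <= j).
Proof.
elim: i => [|i IH].
  by rewrite big_ord0 /excess big_nat big1 // => d /=; rewrite ltnS leqNgt => /negbTE->.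
by have := @excess_row j i 0 isT; rewrite big_ord_recr -IH /=; lia.
Qed.

End Labels.

(** * North-east chains of non-crossing boxes *)

Section Chains.
Variables (n : nat) (P : {set box n}).
Hypothesis P_stair : P \subset stair n.
Local Notation cr := (has_cross P).
Local Notation exc := (excess n cr).

Lemma has_crossE (b : box n) : cr b.1 b.2 = (b \in P).
Proof.
apply/existsP/idP => [[a /and3P[aP /eqP/val_inj a1 /eqP/val_inj a2]]|bP].
  by rewrite (surjective_pairing b) -a1 -a2 -surjective_pairing.
by exists b; rewrite bP !eqxx.
Qed.

Lemma has_cross_stair i c : cr i c -> in_stair n i c.
Proof.
case/existsP => b /and3P[bP /eqP<- /eqP<-].
by have := subsetP P_stair b bP; rewrite inE.
Qed.
Local Notation crs := has_cross_stair.

Lemma ne_step_trans : transitive (@ne_step n).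
Proof.
move=> b a c; rewrite /ne_step => /andP[ab1 ab2] /andP[bc1 bc2].
by rewrite (ltn_trans bc1) // (ltn_trans ab2).
Qed.

Definition in_window (i c j : nat) (b : box n) : bool :=
  [&& b \notin P, b.1 < i & c <= b.2 <= j].

(** Removing the south-west end [b] of a chain leaves a chain in the rows above
    [b] and the columns to its right, and [b] itself contributes one by
    [excess_turn]. *)
Lemma chain_size_excess (j i c : nat) (s : seq (box n)) : c <= j.+1 ->
  sorted (@ne_step n) s -> all (in_window i c j) s -> size s <= exc j i c.
Proof.
elim: s i c => //= b s IH i c cj; rewrite path_sortedE; last exact: ne_step_trans.
case/andP=> bs ss /andP[/and3P[bP bi /andP[cb bj]]] ws.
have bj1 : b.2.+1 <= j.+1 by [].
have := IH b.1 b.2.+1 bj1 ss => {}IH.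
have /IH le : all (in_window b.1 b.2.+1 j) s.
  apply/allP => a as_; have /and3P[aP _ /andP[_ aj]] := allP ws a as_.
  by have /andP[ba1 ba2] := allP bs a as_; rewrite /in_window aP ba1 ba2 aj.
apply: leq_trans (_ : exc j b.1.+1 b.2 <= _).
  by rewrite (excess_turn crs) ?has_crossE.
by apply: (excess_leq crs) => //; exact: ltnW.
Qed.

(** An optimal chain is traced back through the recursion of
    [excess_turn] and [excess_cross]. *)
Lemma chain_of_excess (j i c : nat) : i <= n -> j < n -> c <= j.+1 ->
  exists s, [/\ size s = exc j i c, sorted (@ne_step n) s &
                all (in_window i c j) s].
Proof.
move=> + jn; elim: i c => [|i IHi] c lin cj.
  exists [::]; split=> //; rewrite /excess big_nat big1 // => d /=.
  by rewrite ltnS (leqNgt d) => /andP[_ /negbTE->].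
have win e d a : e <= d -> in_window i d j a -> in_window i.+1 e j a.
  by move=> ed /and3P[aP ai /andP[da aj]]; rewrite /in_window aP aj; lia.
(* Within a row, induction on the number of columns in the window. *)
rewrite -(subKn cj).
elim: (j.+1 - c) (leq_subr c j.+1) => [|d IHd] dj.
  by exists [::]; split=> //; rewrite /excess subn0 big_geq.
set e := j.+1 - d.+1.
have ej : e <= j by rewrite /e; lia.
have ee : j.+1 - d = e.+1 by rewrite /e subnSK.
case crie : (cr i e).
  rewrite (excess_cross crs) //; case: leqP => _; last first.
    have [s [ss sort w]] := IHi e (ltnW lin) (leqW ej).
    by exists s; split=> //; apply: sub_all w => a; apply: win.
  have [s [ss sort w]] := IHd (ltnW dj).
  exists s; rewrite -ee; split=> //; apply: sub_all w => a.
  by rewrite ee /in_window => /and3P[-> -> /andP[/ltnW-> ->]].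
rewrite (excess_turn crs) ?crie //.
have [s [ss sort w]] := IHi e.+1 (ltnW lin) ej.
have en : e < n by apply: leq_ltn_trans jn.
pose b : box n := (Ordinal lin, Ordinal en).
exists (b :: s); split=> /=; first by rewrite ss.
  rewrite path_min_sorted //; apply/allP => a as_.
  by have /and3P[_ ai /andP[ea _]] := allP w a as_; rewrite /ne_step ai ea.
apply/andP; split.
  by rewrite /in_window -has_crossE crie /= ltnSn leqnn.
by apply: sub_all w => a; apply: win.
Qed.

End Chains.

(** * Sticky pipes against ordinary pipes *)

Lemma sum_box n (f : nat -> nat -> bool) :
  \sum_(i < n) \sum_(c < n) f i c = #|[set b : box n | f b.1 b.2]|.
Proof.
rewrite pair_big /= -sum1_card big_mkcond [RHS]big_mkcond /=.
by apply: eq_bigr => b _; rewrite inE; case: (f _ _).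
Qed.

Section Pipes.
Variables (n : nat) (P : {set box n}).
Hypothesis P_stair : P \subset stair n.
Local Notation cr := (has_cross P).
Local Notation top_label := (top_label n cr).
Local Notation left_label := (left_label n cr).
Local Notation effective := (effective n cr).
Local Notation crs := (has_cross_stair P_stair).

(** The label of the pipe that is in the state [(i, c, down)] of [trace]. *)
Definition entering (i c : nat) (down : bool) : nat :=
  if down then top_label i c else left_label i c.+1.

Definition effective_before (i c : nat) : Prop :=
  forall i' c', (i' < i) || (i' == i) && (c < c') -> cr i' c' -> effective i' c'.

Lemma entering_stair i c down : entering i c down < n -> i + c < n.
Proof.
rewrite ltnNge [_ < n]ltnNge; apply: contra => h; rewrite /entering.
by case: down; rewrite ?(top_label_out crs) ?(left_label_out crs); lia.
Qed.

Lemma entering_ge i c down : c + ~~ down <= entering i c down.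
Proof.
rewrite /entering; case: down => /=; rewrite ?addn0 ?addn1.
  exact: (label_ge n cr i).1.
exact: left_label_ge.
Qed.

(** Where all earlier crossings are effective, the label entering a box comes
    from the neighbouring box that [trace] visits just before. *)
Lemma entering_pred i c down : effective_before i c ->
  c < i + entering i c down ->
  exists i' c' down',
    [/\ entering i' c' down' = entering i c down,
        (i'.+1 == i) && (c' == c) || (i' == i) && (c' == c.+1) &
        forall f, behead (trace P f.+1 i' c' down') = trace P f i c down].
Proof.
case: down => eff; last first.
  move=> _; rewrite /entering left_labelE //; last exact: crs.
  case: ifP => [|neff].
    case/andP=> cri _; exists i, c.+1, false; split=> //.
    + by rewrite !eqxx orbT.
    by move=> f /=; rewrite cri.
  have ncr : cr i c.+1 = false.
    by apply: contraFF neff => /eff -> //; rewrite eqxx ltnSn orbT.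
  exists i, c.+1, true; split=> //; first by rewrite !eqxx orbT.
  by move=> f /=; rewrite ncr.
case: i eff => [|i] eff; first by rewrite /entering /= ltnn.
move=> _; rewrite /entering top_labelS; case: ifP => [|neff].
  case/andP=> cri _; exists i, c, true; split=> //; first by rewrite !eqxx.
  by move=> f /=; rewrite cri.
have ncr : cr i c = false.
  by apply: contraFF neff => /eff -> //; rewrite ltnSn.
exists i, c, false; split=> //; first by rewrite !eqxx.
by move=> f /=; rewrite ncr.
Qed.

(** Going back along the label reaches the top of its own column after
    [i + label - c] steps, since each step of a pipe increases row minus
    column by one. *)
Lemma pipe_enters i c down : entering i c down < n -> effective_before i c ->
  exists m, m < 2 * n /\
    drop m (pipe P (entering i c down)) = trace P (2 * n - m) i c down.
Proof.
move=> jn eff; have cj := entering_ge i c down.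
pose m := i + entering i c down - c.
have jm : i + entering i c down = c + m by rewrite /m subnKC //; lia.
exists m; clearbody m; elim: m i c down jn eff cj jm => [|m IH] i c down jn eff cj jm.
  have i0 : i = 0 by lia.
  have dn : down by lia.
  by rewrite i0 dn /= subn0 drop0; split=> //; lia.
have icn := entering_stair jn.
have [||i' [c' [d' [E le tr]]]] // := @entering_pred i c down; first by lia.
have cj' := entering_ge i' c' d'.
have [||||m2 IHm] := IH i' c' d'; rewrite ?E //; try by lia.
  by move=> a b ab; apply: eff; lia.
split; first by lia.
by rewrite -add1n -drop_drop drop1 -E IHm -subnSK // tr.
Qed.

Lemma pipe_visits i c down : entering i c down < n -> effective_before i c ->
  (i, c) \in pipe P (entering i c down).
Proof.
move=> jn eff; have [m [m2 dropm]] := pipe_enters jn eff.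
by apply: (@mem_drop m); rewrite dropm -subnSK // inE eqxx.
Qed.

(** The forward counterpart of [pipe_visits]: following a pipe does not change
    its label. *)
Lemma trace_labels f i c down b : (forall i c, cr i c -> effective i c) ->
  b \in trace P f i c down ->
  top_label b.1 b.2 = entering i c down \/ left_label b.1 b.2.+1 = entering i c down.
Proof.
move=> eff; elim: f i c down => //= f IH i c down.
rewrite inE => /orP[/eqP->|]; first by case: down; [left | right].
case E : (cr i c == down).
  suff -> : entering i c down = entering i.+1 c true by exact: IH.
  rewrite /entering top_labelS /effective; case: down E => /eqP cri; last by rewrite cri.
  by have := eff i c cri; rewrite /effective => ->.
case: c E => [|c] E // /IH; rewrite /entering.
rewrite (left_labelE crs) /effective; case: down E.
  by case: (cr i c.+1) => //=.
by case cri : (cr i c.+1) => // _; have := eff i c.+1 cri; rewrite /effective cri => ->.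
Qed.

Lemma pipe_row_left_label i : (forall i c, cr i c -> effective i c) -> i < n ->
  pipe_row P (left_label i 0) = i.
Proof.
move=> eff lin; have left_n : left_label i 0 < n by apply: (label_lt crs i).2; lia.
have [d [E cd]] : exists d, entering i 0 d = left_label i 0 /\ cr i 0 = ~~ d.
  rewrite (left_labelE crs) /effective; case cri : (cr i 0); last by exists true.
  by exists false; have := eff i 0 cri; rewrite /effective cri => ->.
rewrite -E in left_n *.
have [|m [m2 dropm]] := pipe_enters left_n; first by move=> *; exact: eff.
rewrite /pipe_row -(cat_take_drop m (pipe P _)) dropm last_cat -subnSK //=.
by rewrite cd; case: (d).
Qed.

(** At a first non-effective crossing the larger label [b] precedes the smaller
    [a] in the frontier.  This inversion was created by an earlier effective
    crossing of the same two pipes, and since [trace] follows the labels up to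
    here, the pipes share two crossings. *)
Lemma reduced_effective : reduced P -> forall i c, cr i c -> effective i c.
Proof.
move=> redP.
suff H i c : effective_before i c -> cr i c -> effective i c.
  move=> i; have [m] := ubnP i; elim: m i => // m IHm i im c.
  have [d] := ubnP (n - c); elim: d c => // d IHd c dc; apply: H => i' c' before cri.
  have := crs cri; rewrite /in_stair => st.
  case/orP: before => [lt|/andP[/eqP E lt]]; first by apply: IHm => //; lia.
  by rewrite E in cri *; apply: IHd => //; lia.
move=> eff cri; rewrite /effective cri /= ltnNge; apply/negP => le.
have := crs cri; rewrite /in_stair => st; have cn : c < n by lia.
have lin : i < n by lia.
have ab : left_label i c.+1 < top_label i c.
  by rewrite ltn_neqAle le andbT eq_sym (labels_neq crs).
have an : left_label i c.+1 < n by apply: (label_lt crs i).2; lia.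
have bn : top_label i c < n by apply: (label_lt crs i).1; lia.
set a := left_label i c.+1 in ab an *; set b := top_label i c in ab bn *.
(* This weight singles out the pair of labels that should have crossed. *)
pose e x y := (x == b) && (y == a).
have e_gt x y : e x y -> y < x by case/andP=> /eqP-> /eqP->.
have := frontier_inversions crs e_gt i cn.
have [s1 [s2 [-> _]]] := frontier_step cr i cn.
have := inversions_adjacent e s1 b a s2; rewrite /e !eqxx /= => pos sumE.
have {pos sumE} [i' [c' [before [eff' /eqP lb /eqP ta]]]] : exists i' c',
    ((i' < i) || (i' == i) && (c < c')) /\ [/\ effective i' c',
     left_label i' c'.+1 == b & top_label i' c' == a].
  move: pos; rewrite sumE addn_gt0 !lt0n !sum_nat_seq_neq0.
  case/orP=> /hasP[x]; rewrite mem_index_iota => xi; rewrite /= ?sum_nat_seq_neq0.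
    case/hasP=> y _; rewrite /= eqb0 negbK => /and3P[? ? ?].
    by exists x, y; case/andP: xi => _ ->.
  rewrite eqb0 negbK => /and3P[? ? ?]; exists i, x; rewrite eqxx.
  by case/andP: xi => ->; rewrite orbT.
have /andP[cri' _] := eff'; have := crs cri'; rewrite /in_stair => st'.
have [in' cn'] : i' < n /\ c' < n by lia.
have eff2 : effective_before i' c' by move=> x y xy; apply: eff; lia.
pose B : box n := (Ordinal lin, Ordinal cn).
pose B' : box n := (Ordinal in', Ordinal cn').
have /forallP/(_ (Ordinal an))/forallP/(_ (Ordinal bn))/implyP := redP.
rewrite -val_eqE /= ltn_eqF // => /(_ isT); apply/negP; rewrite -ltnNge.
apply/card_gt1P; exists B, B'; split.
- rewrite inE -has_crossE /= cri.
  by rewrite (@pipe_visits i c false) // (@pipe_visits i c true).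
- rewrite inE -has_crossE /= cri' -[in pipe P a]ta -[in pipe P b]lb.
  by rewrite (@pipe_visits i' c' true) ?(@pipe_visits i' c' false) // /entering ?ta ?lb.
by apply/negP => /eqP[E1 E2]; lia.
Qed.

(** Every crossing shared by two pipes is effective and creates the inversion of
    their labels, which the exits contain at most once. *)
Lemma effective_reduced : (forall i c, cr i c -> effective i c) -> reduced P.
Proof.
move=> eff.
suff H (a b : 'I_n) : a < b -> #|shared_crossings P a b| <= 1.
  apply/forallP => a; apply/forallP => b; apply/implyP => ab.
  case: (ltngtP a b) => [/H //|/H|/val_inj E]; last by rewrite E eqxx in ab.
  rewrite (_ : shared_crossings P b a = shared_crossings P a b) //.
  by apply/setP => x; rewrite !inE andbA andbAC -andbA.
move=> ab; pose e x y := (x == b :> nat) && (y == a :> nat).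
have e_gt x y : e x y -> y < x by case/andP=> /eqP-> /eqP->.
have := exit_inversions crs e_gt.
rewrite (sum_box n (fun x y => (x < y) && e (left_label x 0) (left_label y 0))).
rewrite (sum_box n (fun x y => effective x y && e (left_label x y.+1) (top_label x y))).
move=> E; apply: leq_trans (_ : _ <= #|[set x : box n |
   effective x.1 x.2 && e (left_label x.1 x.2.+1) (top_label x.1 x.2)]|) _.
  apply/subset_leq_card/subsetP => x; rewrite !inE -has_crossE.
  case/and3P => crx /(trace_labels eff) xa /(trace_labels eff) xb.
  have effx := eff _ _ crx; rewrite effx /=; have /andP[_ lt] := effx.
  move: xa xb; rewrite /entering /= /e; lia.
rewrite -E; apply/card_le1_eqP => x y; rewrite !inE /=.
case/and3P=> _ /eqP xb /eqP xa /and3P[_ /eqP yb /eqP ya].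
rewrite (surjective_pairing x) (surjective_pairing y); congr (_, _).
  by apply/val_inj/(exit_inj crs (ltn_ord _) (ltn_ord _)); rewrite /= xb yb.
by apply/val_inj/(exit_inj crs (ltn_ord _) (ltn_ord _)); rewrite /= xa ya.
Qed.

End Pipes.

(** * Permutations of bounded rank *)

Section Permutations.
Variable n : nat.
Implicit Types (s w : 'S_n) (i j : 'I_n).

Definition inversion_set s : {set box n} :=
  [set p : box n | (p.1 < p.2) && (s p.2 < s p.1)].

Lemma card_rothe s : #|rothe s| = #|inversion_set s|.
Proof.
apply: card_imset => -[a b] [c d] /= [-> /perm_inj ->] //.
Qed.

(** Transporting an inversion [(a, b)] by the transposition when this keeps the
    order of positions, and keeping it otherwise, injects the new inversions
    into the old ones and misses [(i, i')]. *)
Lemma tperm_inversions w i i' : i < i' -> w i' < w i ->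
  #|inversion_set (tperm i i' * w)| < #|inversion_set w|.
Proof.
move=> ii ww; set t := tperm i i'.
pose g (p : box n) := if t p.1 < t p.2 then (t p.1, t p.2) else p.
have tK x : t (t x) = x by exact: tpermK.
have g_inj : {in inversion_set (t * w) &, injective g}.
  move=> [a b] [c d]; rewrite !inE /= => /andP[ab _] /andP[cd _]; rewrite /g /=.
  case: ifP => tab; case: ifP => tcd // [E1 E2]; subst.
  - by rewrite -(tK a) -(tK b) E1 E2 !tK.
  - by rewrite !tK ab in tcd.
  - by rewrite !tK cd in tab.
rewrite -(card_in_imset g_inj) proper_card //; apply/properP; split.
  apply/subsetP => _ /imsetP[[a b] + ->]; rewrite !inE /= !permM /g /= => /andP[ab].
  case: ifP => [-> -> //|/negbT]; rewrite -leqNgt ab /= => tba.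
  move: tba; rewrite /t.
  case: (tpermP i i' a) => [?|?|/eqP ai /eqP ai'];
    case: (tpermP i i' b) => [?|?|/eqP bi /eqP bi']; subst; lia.
exists (i, i'); first by rewrite inE /= ii ww.
apply/negP => /imsetP[[a b]]; rewrite inE /= !permM /g /= => /andP[ab tw].
case: ifP => [tab [E1 E2]|_ [E1 E2]].
  by move: ab; rewrite -(tK a) -(tK b) -E1 -E2 /t tpermL tpermR; lia.
by move: tw; rewrite -E1 -E2 /t tpermL tpermR; lia.
Qed.

Definition perm_rank s i j : nat := #|[set a : 'I_n | (a <= i) && (s a <= j)]|.

Lemma card_ord_lt m : #|[set a : 'I_n | a < m]| = minn m n.
Proof.
rewrite cardsE -sum1_card -(big_mkord (fun a => a < m) (fun _ => 1)).
rewrite sum1_count; elim: n => [|p IH]; first by rewrite minn0.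
rewrite /index_iota subn0 -addn1 iotaD count_cat /= add0n addn0.
by rewrite /index_iota subn0 in IH; rewrite IH; lia.
Qed.

Lemma card_perm_lt s m : #|[set a : 'I_n | s a < m]| = minn m n.
Proof.
rewrite -card_ord_lt -[RHS](card_preimset _ (@perm_inj _ s)).
by apply: eq_card => a; rewrite !inE.
Qed.

Section Core.
Variables (lam : seq nat) (k : nat) (s : 'S_n).
Hypothesis lam_part : is_partition lam.
Hypothesis rothe_s : rothe s = shifted_core n lam k.

Definition rank_bounded w : Prop :=
  forall i j, in_shape lam i j -> perm_rank w i j <= k.

Lemma in_shape_down a b i j :
  in_shape lam i j -> a <= i -> b <= j -> in_shape lam a b.
Proof.
rewrite /in_shape => sh ai bj; apply: leq_ltn_trans bj _; apply: leq_trans sh _.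
case: (ltnP i (size lam)) => [li|/(nth_default 0)->] //.
have gt : transitive geq by move=> x y z xy yz; apply: leq_trans xy.
apply: (sorted_leq_nth gt leqnn 0 lam_part) => //; rewrite inE //.
exact: leq_ltn_trans li.
Qed.

Lemma in_core i j :
  (j < s i) && (i < (s^-1)%g j) = [&& in_shape lam i j, k <= i & k <= j].
Proof. by rewrite -in_rothe rothe_s !inE. Qed.

(** The diagram has no box in row [i], so no smaller letter comes later. *)
Lemma fixed_head i : i < k -> s i = i.
Proof.
have [m] := ubnP (val i); elim: m i => // m IH i im ik.
have low (x : 'I_n) : x < i -> s x = x.
  by move=> xi; apply: IH; [apply: leq_trans xi _ | apply: ltn_trans ik].
apply/val_inj/eqP; rewrite eqn_leq; apply/andP; split.
  rewrite leqNgt; apply/negP => lt.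
  have := in_core i i; rewrite lt (leqNgt k) ik andbF /= => /negbT.
  rewrite -leqNgt leq_eqVlt => /orP[/eqP/val_inj E|/low].
    by move: lt; rewrite -{2}E permKV ltnn.
  by rewrite permKV => E; move: lt; rewrite {2}E permKV ltnn.
rewrite leqNgt; apply/negP => lt; have /perm_inj E := low _ lt.
by rewrite E ltnn in lt.
Qed.

(** For a box of the core, everything between it and the corner [(k, k)] lies in
    the diagram, so only the first [k] rows count. *)
Lemma core_rank_bounded : rank_bounded s.
Proof.
move=> i j sh; rewrite /perm_rank.
have head m : #|[set a : 'I_n | a < m]| <= m by rewrite card_ord_lt geq_minl.
case: (ltnP j k) => [jk|kj].
  apply: leq_trans (_ : #|[set a : 'I_n | s a < k]| <= _).
    by apply/subset_leq_card/subsetP => a; rewrite !inE; lia.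
  by rewrite card_perm_lt geq_minl.
apply: leq_trans (head k); apply/subset_leq_card/subsetP => a; rewrite !inE.
case/andP=> ai saj; rewrite ltnNge; apply/negP => ka.
have := in_core a j; rewrite kj ka (in_shape_down sh ai) //.
by rewrite ltnNge saj.
Qed.

(** If [w i < s i], then [(i, w i)] is in the diagram of [s], hence in the shape;
    but there [w] has rank more than [k], counting the first [k] rows and row
    [i] itself. *)
Lemma rank_bounded_first_diff w i : rank_bounded w ->
  (forall x : 'I_n, x < i -> w x = s x) -> w i != s i -> s i < w i.
Proof.
move=> wb low ne; rewrite ltn_neqAle eq_sym val_eqE ne /= leqNgt.
apply/negP => lt.
have iy : i < (s^-1)%g (w i).
  rewrite ltnNge leq_eqVlt; apply/negP => /orP[/eqP/val_inj E|yi].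
    by move: ne; rewrite -{2}E permKV eqxx.
  by have := low _ yi; rewrite permKV => /perm_inj E; rewrite E ltnn in yi.
have := in_core i (w i); rewrite lt iy => /esym/and3P[sh ki kw].
have := wb _ _ sh; rewrite leqNgt => /negP; apply.
have -> : k.+1 = #|i |: [set a : 'I_n | a < k]|.
  by rewrite cardsU1 inE -leqNgt ki card_ord_lt; have := ltn_ord i; lia.
apply/subset_leq_card/subsetP => a; rewrite !inE => /orP[/eqP->|ak].
  by rewrite !leqnn.
by rewrite low ?fixed_head //; lia.
Qed.

(** The swap raises the rank only at the [(a, b)] with [i <= a < i'] and
    [w i' <= b < w i].  If such a box lies in the core then [i < k], for
    otherwise [b < s i].  By minimality of [i'] the rows [i < x <= a] with
    [w x <= b] then have [w x < s i = i], a letter already used above, so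
    only rows of index less than [k] count. *)
Lemma rank_bounded_swap w i i' : rank_bounded w ->
  (forall x : 'I_n, x < i -> w x = s x) -> i < i' -> s i <= w i' < w i ->
  (forall x : 'I_n, i < x -> s i <= w x < w i -> i' <= x) ->
  rank_bounded (tperm i i' * w)%g.
Proof.
move=> wb low ii /andP[sw ww] min a b sh; have wab := wb a b sh.
have E x : (tperm i i' * w)%g x = w (tperm i i' x) by rewrite permM.
case: (leqP i' a) => [i'a|ai'].
  apply: leq_trans wab; rewrite /perm_rank.
  rewrite -[X in X <= _](card_preimset _ (@perm_inj _ (tperm i i'))).
  apply/subset_leq_card/subsetP => x; rewrite !inE E tpermK => /andP[+ ->].
  by case: tpermP => [->|->|_ _] //; lia.
case: (boolP [&& i <= a, w i' <= b & b < w i]) => [/and3P[ia wb1 wb2]|bad]; last first.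
  apply: leq_trans wab; apply/subset_leq_card/subsetP => x; rewrite !inE E.
  case: tpermP => [->|->|_ _] //; last by lia.
  by move: bad; lia.
case: (ltnP b k) => [bk|kb].
  apply: leq_trans (_ : #|[set x : 'I_n | (tperm i i' * w)%g x < k]| <= _).
    by apply/subset_leq_card/subsetP => x; rewrite !inE => /andP[_ /leq_ltn_trans]; apply.
  by rewrite card_perm_lt geq_minl.
have ik : i < k.
  rewrite ltnNge; apply/negP => ki.
  by have := in_core i b; rewrite (in_shape_down sh ia) // ki kb; lia.
apply: leq_trans (_ : #|[set x : 'I_n | x < k]| <= _); last first.
  by rewrite card_ord_lt geq_minl.
apply/subset_leq_card/subsetP => x; rewrite !inE E => /andP[xa].
rewrite ltnNge; case: tpermP => [->|->|/eqP xi /eqP xi'] xb;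
  rewrite -?ltnNge //; first by lia.
rewrite ltnNge; apply/negP => kx.
have ix : i < x by lia.
have lt : w x < i.
  rewrite ltnNge; apply/negP => le.
  by have := min x ix; rewrite fixed_head // le (leq_ltn_trans xb wb2); lia.
have wx : w (w x) = w x by rewrite low // fixed_head //; exact: ltn_trans ik.
by move/perm_inj: wx => wx; move: lt; rewrite wx; lia.
Qed.

(** Descent in Bruhat order: while [w] differs from [s], some transposition
    brings it closer, losing an inversion. *)
Lemma rank_bounded_inversions w : rank_bounded w ->
  w = s \/ #|inversion_set s| < #|inversion_set w|.
Proof.
have [m] := ubnP #|inversion_set w|; elim: m w => // m IH w wm wb.
case: (altP (w =P s)) => [|ne]; [by left | right].
(* The descent acts at the first position where [w] and [s] differ. *)
have [x0 x0P] : exists x, w x != s x.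
  apply/existsP; apply: contraNT ne => /existsPn h; apply/eqP/permP => x.
  exact/eqP/negbNE.
case: (@arg_minnP _ x0 (fun x => w x != s x) val x0P) => i ne_i min_i.
have low (x : 'I_n) : x < i -> w x = s x.
  by move=> xi; apply/eqP; apply: contraLR xi => /min_i; rewrite leqNgt.
have gt := rank_bounded_first_diff wb low ne_i.
(* The letter [s i] occurs in [w] after position [i], so candidates exist. *)
pose cand (x : 'I_n) := (i < x) && (s i <= w x < w i).
have cand0 : cand ((w^-1)%g (s i)).
  rewrite /cand permKV leqnn gt /= andbT ltnNge leq_eqVlt.
  apply/negP => /orP[/eqP/val_inj E|yi].
    by move: ne_i; rewrite -{1}E permKV eqxx.
  by have := low _ yi; rewrite permKV => /perm_inj E; rewrite -E ltnn in yi.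
case: (@arg_minnP _ _ cand val cand0) => i' /andP[ii sww] min_i'.
have lt := tperm_inversions ii (proj2 (andP sww)).
have [||<-|] // := IH (tperm i i' * w)%g.
- exact: leq_trans lt _.
- by apply: rank_bounded_swap => // x ix sx; apply: min_i'; rewrite /cand ix.
by move/ltn_trans; apply.
Qed.

End Core.
End Permutations.

(** * The permutation of a pipe dream *)

Section ExitPermutation.
Variables (n : nat) (P : {set box n}).
Hypothesis P_stair : P \subset stair n.
Local Notation cr := (has_cross P).
Local Notation crs := (has_cross_stair P_stair).

Definition exits_as (w : 'S_n) : Prop := forall i : 'I_n, left_label n cr i 0 = w i.

Lemma exit_permutation : exists w : 'S_n, exits_as w.
Proof.
have lt (i : 'I_n) : left_label n cr i 0 < n.
  by apply: (label_lt crs i).2; rewrite addn0.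
pose f (i : 'I_n) := Ordinal (lt i).
have f_inj : injective f.
  move=> i j /(congr1 val) /= E; apply/val_inj.
  exact: (exit_inj crs (ltn_ord i) (ltn_ord j) E).
by exists (perm f_inj) => i; rewrite permE.
Qed.

Lemma exits_inversions w : exits_as w ->
  #|inversion_set w| = #|[set b in P | effective n cr b.1 b.2]|.
Proof.
move=> Ew; have gt_gt x y : (fun x y => y < x) x y -> y < x by [].
have /= := exit_inversions crs gt_gt.
rewrite (sum_box n (fun x y => (x < y) && (left_label n cr y 0 < left_label n cr x 0))).
rewrite (sum_box n (fun x y => effective n cr x y &&
  (top_label n cr x y < left_label n cr x y.+1))).
have -> : [set b : box n | (b.1 < b.2) &&
      (left_label n cr b.2 0 < left_label n cr b.1 0)] =
    inversion_set w by apply/setP => b; rewrite !inE !Ew.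
move=> ->; apply: eq_card => b.
rewrite !inE -has_crossE /effective.
by case: (cr _ _) => //=; rewrite andbb.
Qed.

Lemma inversions_le_card w : exits_as w -> #|inversion_set w| <= #|P|.
Proof.
move/exits_inversions->; apply/subset_leq_card/subsetP => b.
by rewrite inE => /andP[].
Qed.

(** The inversions are counted by the effective crossings, a subset of [P]. *)
Lemma effective_iff_card w : exits_as w ->
  (forall i c, cr i c -> effective n cr i c) <-> #|inversion_set w| = #|P|.
Proof.
move=> Ew; rewrite (exits_inversions Ew); split=> [eff|/eqP].
  apply: eq_card => b; rewrite inE; case bP : (b \in P) => //=.
  by apply: eff; rewrite has_crossE.
have sub : [set b in P | effective n cr b.1 b.2] \subset P.
  by apply/subsetP => b; rewrite inE => /andP[].
move=> E i c; have /eqP {}E : [set b in P | effective n cr b.1 b.2] == P.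
  by rewrite eqEcard sub (eqP E) leqnn.
case/existsP => b /and3P[bP /eqP <- /eqP <-].
by move/setP/(_ b): E; rewrite inE bP.
Qed.

(** When all crossings are effective, [trace] follows the labels, so that pipe
    [left_label i 0] is the one ending in row [i]. *)
Lemma reduced_pipe_dreamP s :
  (forall i c, cr i c -> effective n cr i c) /\ exits_as s <->
  P \in reduced_pipe_dreams s.
Proof.
rewrite inE P_stair /=; split=> [[eff Es]|/andP[/forallP rows red]].
  rewrite effective_reduced // andbT; apply/forallP => i.
  by rewrite -Es (pipe_row_left_label P_stair).
have eff := reduced_effective P_stair red; split=> // i.
have [w Ew] := exit_permutation; rewrite Ew; congr (val (fun_of_perm _ _)).
apply/permP => j; have := rows ((s^-1)%g (w j)); rewrite permKV -Ew.
by rewrite (pipe_row_left_label P_stair) // => /eqP/val_inj E; rewrite {2}E permKV.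
Qed.

Lemma exits_perm_rank w i j : exits_as w -> perm_rank w i j = excess n cr j i.+1 0.
Proof.
move=> Ew; rewrite (excess_exit crs) /perm_rank -sum1_card.
rewrite (big_ord_widen n (fun a => (left_label n cr a 0 <= j) : nat)) //.
rewrite big_mkcond [RHS]big_mkcond; apply: eq_bigr => a _.
by rewrite inE ltnS Ew; case: (a <= i); case: (w a <= j).
Qed.

End ExitPermutation.

(** * Fillings and reduced pipe dreams of a shape *)

Section ChainGeometry.
Variable n : nat.
Implicit Types (b : box n) (s : seq (box n)) (L : {set box n}).

Lemma ne_path_extent b s : path (@ne_step n) b s ->
  [/\ size s <= b.1, b.2 + size s <= (last b s).2 &
      {in b :: s, forall a : box n, a.1 <= b.1 /\ a.2 <= (last b s).2}].
Proof.
elim: s b => [|c s IH] b /=; first by rewrite addn0; split=> // a; rewrite inE => /eqP->.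
case/andP=> /andP[bc1 bc2] /IH[h1 h2 h3]; split; [lia|lia|].
move=> a; rewrite inE => /orP[/eqP->|/h3[]]; lia.
Qed.

(** The south-east corner of the bounding rectangle; in a Ferrers shape it
    forces the whole rectangle between the origin and itself. *)
Lemma ne_chain_corner L b s : ne_chain L (b :: s) -> (b.1, (last b s).2) \in L.
Proof.
case/and3P=> /ne_path_extent[_ _ ext] _ /subsetP; apply; rewrite inE.
have [h1 _] := ext _ (mem_last b s); have [_ h2] := ext b (mem_head b s).
apply/and4P; split; apply/hasP;
  by [exists b; rewrite ?mem_head | exists (last b s); rewrite ?mem_last].
Qed.

End ChainGeometry.

Section FillingsAndPipeDreams.
Variables (n : nat) (lam : seq nat) (k : nat) (s : 'S_n).
Implicit Types (F P : {set box n}) (w : 'S_n).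
Hypothesis lam_part : is_partition lam.
Hypothesis lam_stair : stair_contains n lam.
Hypothesis rothe_s : rothe s = shifted_core n lam k.
Local Notation L := (ferrers n lam).

Lemma ferrers_stair : L \subset stair n.
Proof. by apply/subsetP => b; rewrite !inE => /lam_stair. Qed.

(** A rank above [k] at [(i, j)] yields a chain of [k.+1] boxes outside the
    complement and inside the rectangle with corner [(i, j)], which lies in the
    shape. *)
Lemma ne_free_rank_bounded F w : ne_free L k F -> exits_as (L :\: F) w ->
  rank_bounded lam k w.
Proof.
case/andP=> FL /forallP free Ew i j sh; set P := L :\: F in Ew.
have Ps : P \subset stair n by apply: subset_trans ferrers_stair; exact: subsetDl.
rewrite (exits_perm_rank Ps _ _ Ew) leqNgt; apply/negP => lt.
have [t [st sort /allP win]] := chain_of_excess Ps (ltn_ord i) (ltn_ord j) (leq0n _).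
have size_t : size (take k.+1 t) == k.+1 by rewrite size_takel // st.
have inL (a : box n) : a.1 <= i -> a.2 <= j -> a \in L.
  by move=> ai aj; rewrite inE (in_shape_down lam_part sh).
have win' (a : box n) : a \in take k.+1 t -> [/\ a \notin P, a.1 <= i & a.2 <= j].
  by move/mem_take/win => /and3P[-> ai /andP[_ aj]].
have := free (Tuple size_t); rewrite (_ : ne_chain _ _) /=.
  case/allPn => a /win'[+ ai aj]; rewrite /P inE /= (inL a ai aj) andbT.
  by rewrite negbK => ->.
apply/and3P; split; first exact: take_sorted.
  by apply/allP => a /win'[_ ai aj]; exact: inL.
apply/subsetP => b; rewrite inE => /and4P[_ /hasP[c ct bc] _ /hasP[d dt bd]].
have [_ ci _] := win' _ ct; have [_ _ dj] := win' _ dt.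
by apply: inL; [apply: leq_trans ci | apply: leq_trans dj].
Qed.

Lemma ne_free_complement F : ne_free L k F ->
  #|rothe s| <= #|L :\: F| /\
  (#|L :\: F| = #|rothe s| -> L :\: F \in reduced_pipe_dreams s).
Proof.
move=> free; have Ps : L :\: F \subset stair n.
  by apply: subset_trans ferrers_stair; exact: subsetDl.
have [w Ew] := exit_permutation Ps.
have wb := ne_free_rank_bounded free Ew; rewrite card_rothe.
have le := inversions_le_card Ps Ew.
have [ws|lt] := rank_bounded_inversions lam_part rothe_s wb; last by split; lia.
rewrite ws in Ew le; split=> // E; apply/(reduced_pipe_dreamP Ps); split=> //.
exact/(effective_iff_card Ps Ew).
Qed.

Lemma pipe_dream_complement_free P : P \in reduced_pipe_dreams s ->
  #|P| = #|rothe s| /\ ne_free L k (L :\: P).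
Proof.
move=> rp; have Ps : P \subset stair n by move: rp; rewrite inE => /and3P[].
have [eff Es] := (reduced_pipe_dreamP Ps s).2 rp.
rewrite card_rothe ((effective_iff_card Ps Es).1 eff); split=> //.
rewrite /ne_free subsetDl /=; apply/forallP => -[[|b t] size_t] //.
apply/implyP => chain; apply/negP => /allP inG.
have corner := ne_chain_corner chain.
have := core_rank_bounded lam_part rothe_s (i := b.1) (j := (last b t).2).
rewrite (exits_perm_rank Ps _ _ Es); move: corner; rewrite inE => /= corner.
move=> /(_ corner); rewrite leqNgt => /negP; apply.
rewrite -[k.+1](eqP size_t); apply: (chain_size_excess Ps) => //.
  by case/and3P: chain.
have /and3P[/ne_path_extent[_ _ ext] _ _] := chain.
apply/allP => a at_; have [a1 a2] := ext a at_.
by have := inG a at_; rewrite !inE => /andP[aP _]; rewrite /in_window aP ltnS a1.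
Qed.

(** The extremal filling leaves empty the core translated [k] columns to the
    left.  A longer chain would start at a box [b] outside the first [k] rows,
    and would reach so far to the right that its corner puts [(b.1, b.2 + k)] in
    the shape, contradicting that [b] is filled. *)
Lemma ne_free_exists : exists2 F, ne_free L k F & #|L :\: F| <= #|rothe s|.
Proof.
pose P0 := [set b in L | (k <= b.1) && in_shape lam b.1 (b.2 + k)].
have P0L : P0 \subset L by apply/subsetP => b; rewrite inE => /andP[].
exists (L :\: P0); last first.
  rewrite setDDr setDv set0U (setIidPr P0L) rothe_s.
  have bn (b : box n) : b \in P0 -> b.2 + k < n.
    rewrite !inE => /and3P[_ _ /lam_stair]; rewrite /in_stair addn1 => /ltnW.
    by apply: leq_ltn_trans; exact: leq_addl.
  pose f (b : box n) : box n := (b.1, insubd b.2 (b.2 + k)).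
  have f2 b : b \in P0 -> (f b).2 = b.2 + k :> nat.
    by move/bn => lt; rewrite /f /= val_insubd lt.
  rewrite -(@card_in_imset _ _ f) => [|b c bP cP E].
    apply/subset_leq_card/subsetP => _ /imsetP[b bP ->].
    rewrite !inE f2 //; move: bP; rewrite !inE => /and3P[_ /= -> ->].
    by rewrite leq_addl.
  have E1 : b.1 = c.1 by case: E.
  have := congr1 (fun x : box n => val x.2) E; rewrite /= !f2 //= => E2.
  rewrite (surjective_pairing b) (surjective_pairing c) E1; congr (_, _).
  by apply/val_inj/eqP; rewrite -(eqn_add2r k) E2.
rewrite /ne_free subsetDl /=; apply/forallP => -[[|b t] //= size_t].
apply/implyP => chain; apply/negP => /andP[bF _].
have := ne_chain_corner chain; rewrite inE /= => corner.
have /and3P[/ne_path_extent[h1 h2 _] _ _] := chain.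
have {}size_t : size t = k by move: size_t => /eqP[].
move: bF; rewrite !inE /= -size_t h1 /= => /andP[+ shb]; rewrite shb /=.
by rewrite (in_shape_down lam_part corner).
Qed.

(** The lower bound of [ne_free_complement] is attained by [ne_free_exists]. *)
Lemma ne_fillingsP F :
  F \in ne_fillings L k <-> ne_free L k F /\ #|L :\: F| = #|rothe s|.
Proof.
rewrite inE; split=> [/andP[free /forallP max]|[free E]].
  split=> //; have [F0 free0 le0] := ne_free_exists.
  apply/eqP; rewrite eqn_leq (ne_free_complement free).1 andbT.
  apply: leq_trans le0; have := max F0; rewrite free0 /= => le.
  have /andP[FL _] := free; have /andP[F0L _] := free0.
  by rewrite !cardsDS // leq_sub2l.
rewrite free /=; apply/forallP => G; apply/implyP => freeG.
have := (ne_free_complement freeG).1; rewrite -E.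
have /andP[FL _] := free; have /andP[GL _] := freeG.
by rewrite !cardsDS // leq_sub2lE // subset_leq_card.
Qed.

(** The part of [P] inside the shape is the complement of a chain-free set, so it
    already has the cardinality of [P]. *)
Lemma pipe_dream_in_shape P : P \in reduced_pipe_dreams s -> P \subset L.
Proof.
move=> /pipe_dream_complement_free[cardP /ne_free_complement[le _]].
apply/setIidPr/eqP; rewrite eqEcard subsetIr cardP.
by rewrite setDDr setDv set0U in le.
Qed.

End FillingsAndPipeDreams.

Theorem theorem1p3 (lam : seq nat) (k n : nat) :
  is_partition lam -> 0 < k -> smallest_stair n lam ->
  {in ne_fillings (ferrers n lam) k &,
     injective (fun F : {set box n} => ferrers n lam :\: F)} /\
  [set ferrers n lam :\: F | F in ne_fillings (ferrers n lam) k]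
    = reduced_pipe_dreams (sigma_k n lam k).
Proof.
move=> part _ [_ st _]; have rs := rothe_sigma_k k part st.
set L := ferrers n lam.
have K (F : {set box n}) : F \subset L -> L :\: (L :\: F) = F.
  by move=> FL; rewrite setDDr setDv set0U (setIidPr FL).
split=> [F G|].
  rewrite !inE => /andP[/andP[FL _] _] /andP[/andP[GL _] _] E.
  by rewrite -(K F FL) E K.
apply/setP => P; apply/imsetP/idP => [[F /(ne_fillingsP part st rs)[free E] ->]|rp].
  exact: (ne_free_complement part st rs free).2.
have PL := pipe_dream_in_shape part st rs rp.
have [cardP free] := pipe_dream_complement_free part rs rp.
exists (L :\: P); last by rewrite K.
by apply/(ne_fillingsP part st rs); rewrite K.
Qed.
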